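(* The vincular patterns $31\text{-}2\text{-}4$ and $13\text{-}2\text{-}4$ are Wilf-equivalent, and the vincular patterns $14\text{-}2\text{-}3$ and $41\text{-}2\text{-}3$ are Wilf-equivalent.
   Context: A vincular pattern is a permutation $\rho\in\mathcal{S}_m$ written with dashes between some consecutive entries; $\pi\in\mathcal{S}_n$ contains it if there are indices $i_1<\cdots<i_m$ with $\pi_{i_1}\cdots\pi_{i_m}$ order-isomorphic to $\rho$ and $i_{j+1}=i_j+1$ whenever $\rho_j,\rho_{j+1}$ are not separated by a dash; otherwise $\pi$ avoids it. Patterns $\rho,\rho'$ are Wilf-equivalent if for every $n\ge0$ the numbers of permutations in $\mathcal{S}_n$ avoiding $\rho$ and avoiding $\rho'$ are equal. *)

(* Defs.v *)
From mathcomp Require Import all_boot all_fingroup.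

Set Implicit Arguments.
Unset Strict Implicit.
Unset Printing Implicit Defensive.

(* A vincular pattern is a permutation in one-line notation (values 1, ..., m)
   cut at its dashes into nonempty blocks: 31-2-4 is
   [:: [:: 3; 1]; [:: 2]; [:: 4]]. *)
Record vincular_pattern := VincularPattern {
  blocks : seq (seq nat);
  blocks_nonempty : [::] \notin blocks;
  blocks_perm : perm_eq (flatten blocks) (iota 1 (size (flatten blocks)))
}.

Definition pattern_word (p : vincular_pattern) : seq nat := flatten (blocks p).

Definition pattern_size (p : vincular_pattern) : nat := size (pattern_word p).

(* Positions are counted from 0. For consecutive j and k, there is no dash
   between them exactly when they lie in the same block. *)
Definition same_block (p : vincular_pattern) (j k : nat) : bool :=
  reshape_index (shape (blocks p)) j == reshape_index (shape (blocks p)) k.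

Definition occurrence (p : vincular_pattern) (n : nat) (pi : 'S_n)
    (i : {ffun 'I_(pattern_size p) -> 'I_n}) : bool :=
  let w := pattern_word p in
  [forall j : 'I_(pattern_size p), forall k : 'I_(pattern_size p),
    [&& (j < k) ==> (i j < i k),
        (pi (i j) < pi (i k)) == (nth 0 w j < nth 0 w k)
      & (k == j.+1 :> nat) && same_block p j k ==> (i k == (i j).+1 :> nat)]].

Definition contains (p : vincular_pattern) (n : nat) (pi : 'S_n) : bool :=
  [exists i : {ffun 'I_(pattern_size p) -> 'I_n}, @occurrence p n pi i].

Definition avoids (p : vincular_pattern) (n : nat) (pi : 'S_n) : bool :=
  ~~ contains p pi.

Definition wilf_equivalent (p q : vincular_pattern) : Prop :=
  forall n : nat,
    #|[set pi : 'S_n | avoids p pi]| = #|[set pi : 'S_n | avoids q pi]|.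

Definition pattern_31_2_4 : vincular_pattern :=
  @VincularPattern [:: [:: 3; 1]; [:: 2]; [:: 4]] isT isT.

Definition pattern_13_2_4 : vincular_pattern :=
  @VincularPattern [:: [:: 1; 3]; [:: 2]; [:: 4]] isT isT.

Definition pattern_14_2_3 : vincular_pattern :=
  @VincularPattern [:: [:: 1; 4]; [:: 2]; [:: 3]] isT isT.

Definition pattern_41_2_3 : vincular_pattern :=
  @VincularPattern [:: [:: 4; 1]; [:: 2]; [:: 3]] isT isT.

(* Main.v *)
Require Import Defs.
From mathcomp Require Import all_boot all_fingroup.
From mathcomp Require Import zify.

(** Both pairs of patterns are of the same kind: an adjacent pair of letters with
values lo < hi is bad when the suffix after it contains letters b, d in this
order with lo < b < hi < d (resp. lo < b < d < hi), and avoiding the two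
patterns of a pair means having no bad descent, resp. no bad ascent.

By inclusion-exclusion it suffices to show, for every set S of positions, that
as many permutations have a bad descent at every position of S as have a bad
ascent at every position of S.  Cut the permutation into the maximal runs glued
by S and reverse each run.  A run of bad descents becomes a run of ascents, and
these are still bad: a witness (b, d) of the badness of an adjacent pair lies to
the right of the whole run, and a suffix starting between two runs makes the
same pairs (lo, hi) bad before and after the reversal.  Indeed, if b and d are
taken from one increasing run, then two consecutive letters of that run form a
bad ascent, whose own witness lies in later runs and can replace d (resp. b and
d). *)

Set Implicit Arguments.
Unset Strict Implicit.
Unset Printing Implicit Defensive.

(** * Runs of glued positions and their reversal *)

Section Runs.
Variables (n : nat) (S : pred nat).
Hypothesis Sn : forall j, S j -> j.+1 < n.

(* [S j] glues the positions j and j.+1; [flip] reverses every maximal run of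
   glued positions. *)
Fact run_start_ex i : exists k, (k <= i) && all S (iota k (i - k)).
Proof. by exists i; rewrite subnn leqnn. Qed.

Fact run_end_ex i : exists k, (i <= k) && ~~ S k.
Proof.
(* By [Sn], no position from [n - 1] on is glued. *)
exists (maxn i n); rewrite leq_maxl; apply/negP => /Sn; lia.
Qed.

(** Both ends belong to the run; its last position is the one not glued to its successor. *)
Definition run_start i := ex_minn (run_start_ex i).
Definition run_end i := ex_minn (run_end_ex i).
Definition flip i := run_start i + run_end i - i.

Lemma run_startP i : [/\ run_start i <= i,
  forall h, run_start i <= h < i -> S h &
  forall k, k <= i -> (forall h, k <= h < i -> S h) -> run_start i <= k].
Proof.
rewrite /run_start; case: ex_minnP => k /andP[ki /allP Sk] kmin; split=> //.
  by move=> h kh; apply: Sk; rewrite mem_iota; lia.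
move=> m mi Sm; apply: kmin; rewrite mi; apply/allP => h.
by rewrite mem_iota => hm; apply: Sm; lia.
Qed.

Lemma run_endP i : [/\ i <= run_end i, ~~ S (run_end i) &
  forall k, i <= k -> ~~ S k -> run_end i <= k].
Proof.
rewrite /run_end; case: ex_minnP => k /andP[ik Sk] kmin.
by split=> // m im Sm; apply: kmin; rewrite im.
Qed.

Lemma mem_run i h : run_start i <= h < run_end i -> S h.
Proof.
have [_ A _] := run_startP i; have [_ _ B] := run_endP i => hi.
case: (ltnP h i) => ih; first by apply: A; lia.
by apply: contraLR hi => /(B _ ih); lia.
Qed.

Lemma run_eq i j : run_start i <= j <= run_end i ->
  run_start j = run_start i /\ run_end j = run_end i.
Proof.
move=> ij; have [si _ mi] := run_startP i; have [ei Ni Mi] := run_endP i.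
have [sj Aj mj] := run_startP j; have [ej Nj Mj] := run_endP j.
have le_end : run_end j <= run_end i by apply: Mj => //; lia.
have ge_end : run_end i <= run_end j.
  case: (leqP i (run_end j)) => h; first exact: Mi.
  by move: Nj; rewrite (@mem_run i) //; lia.
have le_start : run_start j <= run_start i.
  by apply: mj; [lia | move=> h hh; apply: (@mem_run i); lia].
suff: run_start i <= run_start j by lia.
apply: mi; first lia.
by move=> h hh; apply: (@mem_run j); lia.
Qed.

Lemma run_end_lt i : i < n -> run_end i < n.
Proof.
move=> lt_in; have [_ _ M] := run_endP i.
have: run_end i <= n.-1 by apply: M; [lia | apply/negP => /Sn; lia].
lia.
Qed.

Lemma flip_bounds i : run_start i <= flip i <= run_end i.
Proof.
have [? _ _] := run_startP i; have [? _ _] := run_endP i; rewrite /flip; lia.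
Qed.

Lemma flip_lt i : i < n -> flip i < n.
Proof. move=> /run_end_lt; have := flip_bounds i; lia. Qed.

Lemma flipK : involutive flip.
Proof.
move=> i; have [E1 E2] := run_eq (flip_bounds i).
rewrite {1}/flip E1 E2 /flip.
have [? _ _] := run_startP i; have [? _ _] := run_endP i; lia.
Qed.

Lemma run_startS j : S j ->
  run_start j.+1 = run_start j /\ run_end j.+1 = run_end j.
Proof.
move=> Sj; apply: run_eq; have [? _ _] := run_startP j; have [? N _] := run_endP j.
suff: run_end j != j by lia.
by apply: contraNneq N => ->.
Qed.

(** On a run [flip] is subtraction from a constant, so it carries a glued pair to a glued pair read
    backwards. *)
Lemma flipS j : S j -> flip j = (flip j.+1).+1 /\ S (flip j.+1).
Proof.
move=> Sj; have [E1 E2] := run_startS Sj.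
have [sj _ _] := run_startP j; have [ej _ _] := run_endP j.+1.
rewrite /flip E1; rewrite E2 in ej *; split; first lia.
by apply: (@mem_run j); lia.
Qed.

Lemma run_cmp i j : i < j ->
  run_end i < run_start j \/ run_start j = run_start i /\ run_end j = run_end i.
Proof.
move=> ij; have [si _ _] := run_startP i; have [ei N _] := run_endP i.
have [sj A _] := run_startP j.
case: (leqP j (run_end i)) => h; first by right; apply: run_eq; lia.
left; rewrite ltnNge; apply: contra N => h'; apply: A; lia.
Qed.

End Runs.

(* [c = true] is the case of 31-2-4 and 13-2-4, [c = false] that of 41-2-3 and
   14-2-3. *)
Definition witness (c : bool) (lo hi b d : nat) : bool :=
  [&& lo < b, b < hi, b < d & if c then hi < d else d < hi].

Definition bad c n (f : nat -> nat) (j lo hi : nat) : bool :=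
  [exists k : 'I_n, exists l : 'I_n,
    [&& j < k, k < l & witness c lo hi (f k) (f l)]].

Definition bad_descent c n (f : nat -> nat) (j : nat) : bool :=
  [&& j.+1 < n, f j.+1 < f j & bad c n f j.+1 (f j.+1) (f j)].

Definition bad_ascent c n (f : nat -> nat) (j : nat) : bool :=
  [&& j.+1 < n, f j < f j.+1 & bad c n f j.+1 (f j) (f j.+1)].

Lemma badP c n f j lo hi :
  reflect (exists k l, [/\ j < k < l, l < n & witness c lo hi (f k) (f l)])
          (bad c n f j lo hi).
Proof.
apply: (iffP existsP) => [[k /existsP[l /and3P[jk kl w]]]|[k [l [jk ln w]]]].
  by exists k, l; rewrite jk kl ltn_ord.
have kn : k < n by lia.
exists (Ordinal kn); apply/existsP; exists (Ordinal ln) => /=.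
by case/andP: jk => -> ->.
Qed.

(** * Run reversal exchanges bad descents and bad ascents *)

Section Flip.
Variables (c : bool) (n : nat) (S : pred nat).
Hypothesis Sn : forall j, S j -> j.+1 < n.
Local Notation r := (flip Sn).
Local Notation rs := (run_start S).
Local Notation re := (run_end Sn).

Lemma run_mono (R : rel nat) (f : nat -> nat) i k : transitive R ->
  (forall j, S j -> R (f j) (f j.+1)) -> i < k <= re i -> R (f i) (f k).
Proof.
move=> Rt fS; have [si _ _] := run_startP S i.
elim: k => // k IH ik.
have Rk : R (f k) (f k.+1) by apply/fS/(@mem_run _ _ Sn i); lia.
have [-> //|ne] := eqVneq i k.
by apply: Rt Rk; apply: IH; lia.
Qed.

Lemma flip_descents f : (forall j, S j -> bad_descent c n f j) ->
  forall j, S j -> bad_ascent c n (f \o r) j.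
Proof.
move=> D j Sj; have [E1 Sq] := flipS Sn Sj; have [_ Ej] := run_startS Sn Sj.
have decr i k : i < k <= re i -> f k < f i.
  apply: (@run_mono (fun x y => y < x)) => [x y z xy yz|h /D/and3P[]//].
  exact: ltn_trans yz xy.
have [_ Eq] := run_startS Sn Sq.
have [_ Er] := run_eq (flip_bounds Sn j.+1); set q := r j.+1 in E1 Sq Eq Er *.
rewrite /bad_ascent Sn //= E1 -/q.
case/and3P: (D _ Sq) => _ -> /badP[k [l [jk ln w]]] /=.
have [ek _ _] := run_endP Sn k; have [el _ _] := run_endP Sn l.
have [ej _ _] := run_endP Sn j.+1.
case/and4P: (w) => lob bhi bd _.
(* After [q.+1] the run stays below [lo = f q.+1], so [b > lo] lies in a later run. *)
have qk : re q < rs k.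
  case: (@run_cmp _ _ Sn q k ltac:(lia)) => // -[_ E].
  have := @decr q.+1 k ltac:(lia); lia.
(* A descending run cannot contain [b] before [d], as [b < d]. *)
have kl : re k < rs l.
  case: (@run_cmp _ _ Sn k l ltac:(lia)) => // -[_ E].
  have := @decr k l ltac:(lia); lia.
apply/badP; exists (r k), (r l); rewrite /= !flipK w flip_lt //; split=> //.
have := flip_bounds Sn k; have := flip_bounds Sn l; lia.
Qed.

(* Two letters of the same increasing run can be replaced by letters of
   different runs, which keep their relative order when the runs are reversed. *)
Lemma ascents_separate g lo hi k l : (forall j, S j -> bad_ascent c n g j) ->
  k < l < n -> witness c lo hi (g k) (g l) ->
  exists k' l',
    [/\ k <= k', re k' < rs l', l' < n & witness c lo hi (g k') (g l')].
Proof.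
move=> A; have incr i h : i < h <= re i -> g i < g h.
  by apply: (@run_mono ltn) => [|m /A/and3P[]//]; apply: ltn_trans.
have [m] := ubnP (n - k); elim: m k l => // m IH k l nk kl w.
case: (@run_cmp _ _ Sn k l ltac:(lia)) => [sep|[Es Ee]].
  by exists k, l; split=> //; lia.
have [el _ _] := run_endP Sn l; have [sk _ _] := run_startP S k.
(* Letters of the run beyond [p.+1] exceed [g p.+1], so the witness of the bad ascent at [p] lies in
   later runs. *)
have step p : k <= p < l -> exists k' l',
    [/\ p < k' < l', re p < rs k', re p < rs l', l' < n
      & witness c (g p) (g p.+1) (g k') (g l')].
  move=> kp; have Sp : S p by apply: (@mem_run _ _ Sn k); lia.
  have [_ Ep] := run_startS Sn Sp.
  case/and3P: (A _ Sp) => _ _ /badP[k' [l' [pk ln w']]].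
  case/and4P: (w') => _ b' _ _; exists k', l'.
  have pk' : re p < rs k'.
    case: (@run_cmp _ _ Sn p k' ltac:(lia)) => // -[_ E].
    have [? _ _] := run_endP Sn k'; have := @incr p.+1 k' ltac:(lia); lia.
  split=> //; first lia.
  have [? _ _] := run_endP Sn k'; have [? _ _] := run_startP S k'.
  by case: (@run_cmp _ _ Sn k' l' ltac:(lia)) => [|[]]; lia.
(* For [c = false], the ascent at [k] has a witness between [g k] and [g k.+1 <= g l < hi], which
   replaces both letters. Its letters may again share a run, hence the induction. *)
case/and4P: w => lob bhi bd; case cE: c step IH => step IH /= dhi; last first.
  have [k' [l' [pk' _ _ ln /and4P[w1 w2 w3 w4]]]] := step k ltac:(lia).
  have lk : g k.+1 <= g l.
    have [->//|ne] := eqVneq k.+1 l.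
    have Sk : S k by apply: (@mem_run _ _ Sn k); lia.
    by have [_ E] := run_startS Sn Sk; have := @incr k.+1 l ltac:(lia); lia.
  have [|||k2 [l2 [? ? ? ?]]] := IH k' l'; try lia.
    by rewrite /witness; apply/and4P; split=> /=; lia.
  by exists k2, l2; split=> //; lia.
(* For [c = true], let [p] be the last position before [l] where the run is below [hi]. The witness
   at [p] gives [hi <= g p.+1 < g l'], so [p] and [l'] serve. *)
have exP : exists p, (k <= p < l) && (g p < hi) by exists k; lia.
have ubP p : (k <= p < l) && (g p < hi) -> p <= l by lia.
case: (ex_maxnP exP ubP) => p /andP[kp gp] pmax.
have hip : hi <= g p.+1.
  rewrite leqNgt; apply/negP => lt.
  have [E|ne] := eqVneq p.+1 l; first by rewrite E in lt; lia.
  by have := pmax p.+1; lia.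
have [k' [l' [pk' _ pl ln /and4P[w1 w2 w3 w4]]]] := step p kp.
exists p, l'; split=> //; first lia.
have kgp : g k <= g p.
  have [->//|ne] := eqVneq k p.
  by have := @incr k p ltac:(lia); lia.
by rewrite /witness; apply/and4P; split=> /=; lia.
Qed.

Lemma flip_ascents g : (forall j, S j -> bad_ascent c n g j) ->
  forall j, S j -> bad_descent c n (g \o r) j.
Proof.
move=> A j Sj; have [E1 Sq] := flipS Sn Sj; have [_ Ej] := run_startS Sn Sj.
have incr i h : i < h <= re i -> g i < g h.
  by apply: (@run_mono ltn) => [|m /A/and3P[]//]; apply: ltn_trans.
have [_ Eq] := run_startS Sn Sq.
have [_ Er] := run_eq (flip_bounds Sn j.+1); set q := r j.+1 in E1 Sq Eq Er *.
rewrite /bad_descent Sn //= E1 -/q.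
case/and3P: (A _ Sq) => _ -> /badP[k [l [jk ln w]]] /=.
case/and4P: (w) => lob bhi bd _.
have [ek _ _] := run_endP Sn k.
have [ej _ _] := run_endP Sn j.+1.
(* After [q.+1] the run stays above [hi = g q.+1], so [b < hi] lies in a later run. *)
have qk : re q < rs k.
  case: (@run_cmp _ _ Sn q k ltac:(lia)) => // -[_ E].
  have := @incr q.+1 k ltac:(lia); lia.
have [|k' [l' [kk' kl' ln' w']]] := ascents_separate A _ w; first lia.
have qk' : re q < rs k'.
  have [<-//|ne] := eqVneq k k'.
  have [? _ _] := run_startP S k.
  by case: (@run_cmp _ _ Sn k k' ltac:(lia)) => [|[]]; lia.
apply/badP; exists (r k'), (r l'); rewrite /= !flipK w' flip_lt //; split=> //.
have := flip_bounds Sn k'; have := flip_bounds Sn l'; lia.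
Qed.
End Flip.

(** * Inclusion-exclusion and the count of permutations *)

Lemma card_empty_eq (T I : finType) (A B : T -> {set I}) :
  (forall U : {set I}, #|[set t | U \subset A t]| = #|[set t | U \subset B t]|) ->
  #|[set t | A t == set0]| = #|[set t | B t == set0]|.
Proof.
move=> AB.
(* Induction on [V]: according to membership of [x], the count for [U] and [V :\ x] is the one for
   [x |: U] and [V :\ x] plus the one for [U] and [V]. The claim is the case [U = set0],
   [V = setT]. *)
have main (V U : {set I}) :
    #|[set t | (U \subset A t) && [disjoint V & A t]]|
    = #|[set t | (U \subset B t) && [disjoint V & B t]]|.
  have [m] := ubnP #|V|; elim: m V U => // m IH V U Vm.
  have [->|[x xV]] := set_0Vmem V.
    have E (C : T -> {set I}) : [set t | (U \subset C t) && [disjoint set0 & C t]]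
      = [set t | U \subset C t].
      by apply/setP => t; rewrite !inE -setI_eq0 set0I eqxx andbT.
    by rewrite !E.
  have split (C : T -> {set I}) :
      #|[set t | (U \subset C t) && [disjoint V :\ x & C t]]|
      = #|[set t | (x |: U \subset C t) && [disjoint V :\ x & C t]]|
        + #|[set t | (U \subset C t) && [disjoint V & C t]]|.
    rewrite -(cardsID [set t | x \in C t]).
    congr (_ + _); apply: eq_card => t; rewrite !inE.
      by rewrite subUset sub1set andbC -andbA.
    rewrite -!setI_eq0 -{2}(setD1K xV) setIUl setU_eq0.
    rewrite [[set x] :&: _ == _]setI_eq0 disjoints1.
    by case: (x \in C t) => //=; rewrite ?andbF.
  have Vx : #|V :\ x| < m by rewrite (cardsD1 x) xV in Vm; lia.
  have := split A; rewrite (IH _ _ Vx) (IH _ (x |: U) Vx) split; lia.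
have E (C : T -> {set I}) : [set t | C t == set0] =
    [set t | (set0 \subset C t) && [disjoint setT & C t]].
  by apply/setP => t; rewrite !inE sub0set -setI_eq0 setTI.
by rewrite !E.
Qed.

(* One-line notation on positions 0, ..., n - 1, extended by 0. *)
Definition word n (pi : 'S_n) (j : nat) : nat :=
  oapp (fun i : 'I_n => val (pi i)) 0 (insub j).

Lemma wordE n (pi : 'S_n) (i : 'I_n) : word pi i = pi i.
Proof. by rewrite /word valK. Qed.

Lemma card_no_bad c n :
  #|[set pi : 'S_n | [forall j : 'I_n, ~~ bad_descent c n (word pi) j]]|
  = #|[set pi : 'S_n | [forall j : 'I_n, ~~ bad_ascent c n (word pi) j]]|.
Proof.
pose D (pi : 'S_n) := [set j : 'I_n | bad_descent c n (word pi) j].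
pose A (pi : 'S_n) := [set j : 'I_n | bad_ascent c n (word pi) j].
have E0 (B : 'S_n -> pred nat) :
    [set pi | [forall j : 'I_n, ~~ B pi j]]
    = [set pi | [set j : 'I_n | B pi j] == set0].
  apply/setP => pi; rewrite !inE; apply/forallP/eqP => [H|H j].
    by apply/setP => j; rewrite !inE; apply/negbTE.
  by have := in_set0 j; rewrite -H inE => ->.
rewrite (E0 (fun pi => bad_descent c n (word pi))).
rewrite (E0 (fun pi => bad_ascent c n (word pi))).
apply: (@card_empty_eq _ _ D A) => U.
(* If [U] contains the last position, no adjacent pair starts there and both counts are zero. *)
have [/forallP Un|/forallPn[j]] :=
  boolP [forall j : 'I_n, (j \in U) ==> (j.+1 < n)]; last first.
  rewrite negb_imply => /andP[jU jn].
  rewrite !eq_card0 // => pi; rewrite !inE; apply/negbTE/subsetPn;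
    by exists j; rewrite ?inE // /bad_ascent /bad_descent (negbTE jn).
pose S (j : nat) := [exists i in U, val i == j].
have Sn j : S j -> j.+1 < n.
  by case/existsP => i /andP[iU /eqP <-]; have /implyP := Un i; apply.
have SU (i : 'I_n) : S i = (i \in U).
  apply/existsP/idP => [[k /andP[kU /eqP/val_inj <-]]//|iU].
  by exists i; rewrite iU eqxx.
pose rn (i : 'I_n) := Ordinal (flip_lt Sn (ltn_ord i)).
have rnK : involutive rn by move=> i; apply: val_inj; rewrite /= flipK.
pose rho : 'S_n := perm (inv_inj rnK).
(* In [rho * pi] the factor [rho] acts first, hence on positions. *)
have wrho (pi : 'S_n) (j : nat) : j < n -> word (rho * pi)%g j = word pi (flip Sn j).
  move=> jn; rewrite -[j]/(val (Ordinal jn)) wordE permM permE.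
  by rewrite -(wordE pi (rn _)).
have rho_inv : (rho * rho)%g = 1%g.
  by apply/permP => i; rewrite permM !permE rnK.
(* The two words in [wrho] are compared only below [n]; [bad] reads no other letters. *)
have bad_ext f g j lo hi :
    (forall i, i < n -> f i = g i) -> bad c n f j lo hi = bad c n g j lo hi.
  by move=> fg; apply: eq_existsb => k; apply: eq_existsb => l; rewrite !fg.
have DS pi : U \subset D pi -> forall j, S j -> bad_descent c n (word pi) j.
  move=> /subsetP UD j /existsP[i /andP[iU /eqP <-]].
  by have := UD i iU; rewrite inE.
have AS pi : U \subset A pi -> forall j, S j -> bad_ascent c n (word pi) j.
  move=> /subsetP UD j /existsP[i /andP[iU /eqP <-]].
  by have := UD i iU; rewrite inE.
have Drho pi : U \subset D pi -> U \subset A (rho * pi)%g.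
  move=> /DS/(flip_descents Sn) H; apply/subsetP => i; rewrite -SU inE => Si.
  have in' := Sn _ Si; have := H _ Si.
  by rewrite /bad_ascent !wrho // (bad_ext _ _ _ _ _ (wrho pi)) //.
have Arho pi : U \subset A pi -> U \subset D (rho * pi)%g.
  move=> /AS/(flip_ascents Sn) H; apply/subsetP => i; rewrite -SU inE => Si.
  have in' := Sn _ Si; have := H _ Si.
  by rewrite /bad_descent !wrho // (bad_ext _ _ _ _ _ (wrho pi)) //.
rewrite -[LHS](card_imset _ (@mulgI _ rho)); apply: eq_card => pi; rewrite inE.
apply/imsetP/idP => [[s]|H]; first by rewrite inE => /Drho H ->.
by exists (rho * pi)%g; rewrite ?inE ?Arho // mulgA rho_inv mul1g.
Qed.

(** * From pattern occurrences to bad adjacent pairs *)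

Lemma contains_2_1_1P w0 w1 w2 w3 ne perm n (pi : 'S_n) :
  let f := word pi in
  reflect (exists j k l, [/\ j.+1 < k < l, l < n & forall x y, x < 4 -> y < 4 ->
      (nth 0 [:: f j; f j.+1; f k; f l] x < nth 0 [:: f j; f j.+1; f k; f l] y)
      = (nth 0 [:: w0; w1; w2; w3] x < nth 0 [:: w0; w1; w2; w3] y)])
    (contains (@VincularPattern [:: [:: w0; w1]; [:: w2]; [:: w3]] ne perm) pi).
Proof.
move=> f; apply: (iffP existsP) => [[i /forallP oc]|[j [k [l [jkl ln H]]]]].
  pose a0 : 'I_4 := @Ordinal 4 0 isT; pose a1 : 'I_4 := @Ordinal 4 1 isT.
  pose a2 : 'I_4 := @Ordinal 4 2 isT; pose a3 : 'I_4 := @Ordinal 4 3 isT.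
  have o x y := forallP (oc x) y.
  have /= /and3P[_ _ /eqP E] := o a0 a1.
  have /= /and3P[lt12 _ _] := o a1 a2.
  have /= /and3P[lt23 _ _] := o a2 a3.
  exists (i a0), (i a2), (i a3); rewrite -E lt12 lt23; split=> // x y x4 y4.
  have fi z (z4 : z < 4) :
      nth 0 [:: f (i a0); f (i a1); f (i a2); f (i a3)] z = pi (i (Ordinal z4)).
    by case: z z4 => [|[|[|[|//]]]] z4 /=; rewrite /f wordE; congr (val (pi (i _)));
      apply: val_inj.
  rewrite (fi _ x4) (fi _ y4).
  by have /and3P[_ /eqP -> _] := o (Ordinal x4) (Ordinal y4).
have jn : j < n by lia.
have j1n : j.+1 < n by lia.
have kn : k < n by lia.
pose t := [:: Ordinal jn; Ordinal j1n; Ordinal kn; Ordinal ln].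
exists [ffun x : 'I_4 => nth (Ordinal jn) t x].
apply/forallP => x; apply/forallP => y; rewrite !ffunE.
have ft (z : 'I_4) :
    val (pi (nth (Ordinal jn) t z)) = nth 0 [:: f j; f j.+1; f k; f l] z.
  by case: z => [[|[|[|[|//]]]] z4] /=; rewrite -wordE.
have := H x y (ltn_ord x) (ltn_ord y); rewrite -!ft => ->; rewrite eqxx /=.
case/andP: jkl => jk kl.
by case: x y => [[|[|[|[|//]]]] ?] [[|[|[|[|//]]]] ?] //=; lia.
Qed.

(** Treats the four patterns at once: [Q] is the order type of the pattern spelled out as
    inequalities, [B j] says that an occurrence starts at [j]. *)
Lemma avoids_bad w0 w1 w2 w3 ne perm n (pi : 'S_n)
    (Q : nat -> nat -> nat -> nat -> bool) (B : pred nat) :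
  let f := word pi in
  (forall a b u v, Q a b u v <-> forall x y, x < 4 -> y < 4 ->
      (nth 0 [:: a; b; u; v] x < nth 0 [:: a; b; u; v] y)
      = (nth 0 [:: w0; w1; w2; w3] x < nth 0 [:: w0; w1; w2; w3] y)) ->
  (forall j, reflect
     (exists k l, [/\ j.+1 < k < l, l < n & Q (f j) (f j.+1) (f k) (f l)]) (B j)) ->
  avoids (@VincularPattern [:: [:: w0; w1]; [:: w2]; [:: w3]] ne perm) pi
  = [forall j : 'I_n, ~~ B j].
Proof.
move=> f QP BP; rewrite /avoids -[RHS]negbK negb_forall; congr (~~ _).
apply/contains_2_1_1P/existsP => [[j [k [l [jkl ln /QP H]]]]|[j]].
  have jn : j < n by lia.
  by exists (Ordinal jn); rewrite negbK; apply/BP; exists k, l.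
rewrite negbK => /BP[k [l [jkl ln /QP H]]].
by exists j, k, l.
Qed.

Definition descent_letters c a b u v := (b < a) && witness c b a u v.

Definition ascent_letters c a b u v := (a < b) && witness c a b u v.

Lemma bad_descentP c n f j :
  reflect (exists k l, [/\ j.+1 < k < l, l < n
             & descent_letters c (f j) (f j.+1) (f k) (f l)])
          (bad_descent c n f j).
Proof.
rewrite /descent_letters;
  apply: (iffP and3P) => [[? lt /badP[k [l [? ? ?]]]]|[k [l [? ? /andP[-> ?]]]]].
  by exists k, l; rewrite lt.
by split=> //; [lia | apply/badP; exists k, l].
Qed.

Lemma bad_ascentP c n f j :
  reflect (exists k l, [/\ j.+1 < k < l, l < n
             & ascent_letters c (f j) (f j.+1) (f k) (f l)])
          (bad_ascent c n f j).
Proof.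
rewrite /ascent_letters;
  apply: (iffP and3P) => [[? lt /badP[k [l [? ? ?]]]]|[k [l [? ? /andP[-> ?]]]]].
  by exists k, l; rewrite lt.
by split=> //; [lia | apply/badP; exists k, l].
Qed.

(** The five inequalities determine all sixteen comparisons of the four letters, and each of them is
    one of these comparisons. *)
Ltac compare_letters :=
  let H := fresh in
  move=> ? ? ? ?; rewrite /descent_letters /ascent_letters /witness; split=> [/= ?|];
  [ by case=> [|[|[|[|?]]]] [|[|[|[|?]]]] //= _ _; lia
  | intro H; apply/and5P; split;
    first [ exact: (H 1 0 isT isT) | exact: (H 0 1 isT isT) | exact: (H 2 0 isT isT)
          | exact: (H 0 2 isT isT) | exact: (H 2 1 isT isT) | exact: (H 1 2 isT isT)
          | exact: (H 3 0 isT isT) | exact: (H 0 3 isT isT) | exact: (H 3 1 isT isT)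
          | exact: (H 1 3 isT isT) | exact: (H 2 3 isT isT) ] ].

Lemma avoids_31_2_4 n (pi : 'S_n) : avoids pattern_31_2_4 pi =
  [forall j : 'I_n, ~~ bad_descent true n (word pi) j].
Proof. by apply: (avoids_bad _ _ _ (bad_descentP true n _)); compare_letters. Qed.

Lemma avoids_13_2_4 n (pi : 'S_n) : avoids pattern_13_2_4 pi =
  [forall j : 'I_n, ~~ bad_ascent true n (word pi) j].
Proof. by apply: (avoids_bad _ _ _ (bad_ascentP true n _)); compare_letters. Qed.

Lemma avoids_41_2_3 n (pi : 'S_n) : avoids pattern_41_2_3 pi =
  [forall j : 'I_n, ~~ bad_descent false n (word pi) j].
Proof. by apply: (avoids_bad _ _ _ (bad_descentP false n _)); compare_letters. Qed.

Lemma avoids_14_2_3 n (pi : 'S_n) : avoids pattern_14_2_3 pi =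
  [forall j : 'I_n, ~~ bad_ascent false n (word pi) j].
Proof. by apply: (avoids_bad _ _ _ (bad_ascentP false n _)); compare_letters. Qed.

Theorem theorem5p5 :
  wilf_equivalent pattern_31_2_4 pattern_13_2_4 /\
  wilf_equivalent pattern_14_2_3 pattern_41_2_3.
Proof.
have set_ext n (P Q : pred 'S_n) : P =1 Q -> [set pi | P pi] = [set pi | Q pi].
  by move=> PQ; apply/setP => pi; rewrite !inE.
split=> n.
  rewrite (set_ext _ _ _ (@avoids_31_2_4 n)) (set_ext _ _ _ (@avoids_13_2_4 n)).
  exact: card_no_bad.
rewrite (set_ext _ _ _ (@avoids_14_2_3 n)) (set_ext _ _ _ (@avoids_41_2_3 n)).
exact/esym/card_no_bad.
Qed.
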